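(* Let $M\ge2$ be an integer, $A>1$ and $q>0$. We have, for any integer $n$ such that $\log M\le 16(\min(1,A-1))^2 n$, $$\sup_{f_1,\dots,f_M\in\mathcal{F}_v(A)}\ \inf_{\hat f_n}\ \sup_{f\in\mathcal{F}(A)}\left[\mathbb{E}_f\left[v(f,\hat f_n)^q\right]-\min_{j=1,\dots,M}v(f,f_j)^q\right]\ge c\left(\frac{\log M}{n}\right)^{q/2},$$ where $c$ is a positive constant which depends only on $A$.
   Context: Setting: $X_1,\dots,X_n$ are i.i.d. observations in $\mathbb{R}^d$ drawn from an unknown probability with density $f$ with respect to the Lebesgue measure on $\mathbb{R}^d$; $\mathbb{E}_f$ is the expectation when the true density is $f$. $\mathcal{F}(A)$ is the set of densities on $\mathbb{R}^d$ bounded by $A$; $\mathcal{F}_v(A)$ is the set of measurable (real-valued) functions on $\mathbb{R}^d$ bounded by $A$. The infimum $\inf_{\hat f_n}$ is over all estimators based on a sample of size $n$. $L_1$-distance: for measurable functions $f,g$, $v(f,g)=\int_{\mathbb{R}^d}|f-g|\,dx$.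
   Formalization: The constant c is allowed to depend on q as well as on A: with A=2, M=3, n=1 the estimator 0 makes the left side at most 1 for every q, while (log 3)^{q/2} is unbounded in q, so no c depending only on A exists. *)

(* Defs.v *)
From HB Require Import structures.
From mathcomp Require Import all_boot all_order all_algebra.
From mathcomp Require Import all_classical all_reals all_analysis.

Set Implicit Arguments.
Unset Strict Implicit.
Unset Printing Implicit Defensive.

Import Order.TTheory GRing.Theory Num.Theory.
Import numFieldNormedType.Exports.

Local Open Scope classical_set_scope.
Local Open Scope ring_scope.
Local Open Scope ereal_scope.

(* The n-fold product of m, carried by n.-tuple T with the library's product
   sigma-algebra (generated by the coordinates tnth).  It is the product measure
   when m is sigma-finite; for a probability m it is the law of an i.i.d.
   sample of size n from m. *)
Fixpoint tuple_power (R : realType) (disp : measure_display)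
    (T : measurableType disp) (m : set T -> \bar R) (n : nat) :
    set (n.-tuple T) -> \bar R :=
  match n with
  | 0%N => \d_ [tuple]
  | n'.+1 => pushforward (m \x @tuple_power R disp T m n')
      (fun p : T * n'.-tuple T => [tuple of p.1 :: p.2])
  end.
Arguments tuple_power {R disp T} m n _.

(* R^k.  measurableTypeR R is R with its Borel sigma-algebra: it is the carrier
   of lebesgue_measure, hence its use here instead of R. *)
Notation Rk R k := (k.-tuple (measurableTypeR R)).

Definition lebesgue_Rk (R : realType) (k : nat) : set (Rk R k) -> \bar R :=
  tuple_power (@lebesgue_measure R) k.
Arguments lebesgue_Rk {R} k _.

Definition v_dist (R : realType) (k : nat) (f g : Rk R k -> R) : \bar R :=
  \int[lebesgue_Rk k]_x `|f x - g x|%:E.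

(* The class F_v(A). *)
Definition bounded_functions (R : realType) (k : nat) (A : R) :
    set (Rk R k -> R) :=
  [set f : Rk R k -> R | measurable_fun setT f /\ forall x, (`|f x| <= A)%R].

(* The class F(A). *)
Definition bounded_densities (R : realType) (k : nat) (A : R) :
    set (Rk R k -> R) :=
  [set f : Rk R k -> R | [/\ measurable_fun setT f,
             forall x, (0 <= f x <= A)%R &
             \int[lebesgue_Rk k]_x (f x)%:E = 1]].

Definition density_law (R : realType) (k : nat) (f : Rk R k -> R) :
    set (Rk R k) -> \bar R :=
  fun B => \int[lebesgue_Rk k]_(x in B) (f x)%:E.

(* E_f[Y] for a nonnegative, possibly infinite function Y of the sample
   X_1, ..., X_n; the sample space is (R^k)^n, with X_i the i-th coordinate. *)
Definition expect (R : realType) (k n : nat) (f : Rk R k -> R)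
    (Y : n.-tuple (Rk R k) -> \bar R) : \bar R :=
  \int[tuple_power (density_law f) n]_s Y s.

(* Joint measurability in the sample and the point makes the loss
   v_dist f (fhat s) a measurable function of the sample s. *)
Definition estimators (R : realType) (k n : nat) :
    set (n.-tuple (Rk R k) -> Rk R k -> R) :=
  [set fhat : n.-tuple (Rk R k) -> Rk R k -> R | measurable_fun setT
     (fun p : n.-tuple (Rk R k) * Rk R k => fhat p.1 p.2)].

(* E_f[v(f, fhat)^q] - min_j v(f, f_j)^q.  Since the f_j need not be
   integrable, the minimum may be +oo; the difference is then -oo, also when
   the expectation is +oo (library convention +oo - +oo = -oo). *)
Definition excess_risk (R : realType) (k n M : nat) (q : R)
    (fs : 'I_M -> Rk R k -> R)
    (fhat : n.-tuple (Rk R k) -> Rk R k -> R)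
    (f : Rk R k -> R) : \bar R :=
  expect f (fun s => v_dist f (fhat s) `^ q)
  - \big[mine/+oo]_(j < M) (v_dist f (fs j) `^ q).

(* Main.v *)
(** The f_j are densities themselves: with M Rademacher functions r_j of the
    first coordinate of the unit cube, let f_j = 1 + eps r_j on the cube, where
    eps = sqrt (log M / n) / 4. These are at mutual L1-distance exactly eps, so
    at most one f_j lies within eps / 2 of the estimate. Let L_j be the
    likelihood ratio of the sample under f_j with respect to the uniform law Q,
    so that E_Q L_j^2 = (1 + eps^2)^n =: a <= sqrt M, and let B_j be the event
    that the estimate is eps / 2-close to f_j. As the B_j are disjoint,
    2 L_j 1_(B_j) <= L_j^2 / a + a 1_(B_j) shows that the average over j of
    P_j (B_j) is at most (1 + a / M) / 2 < 7 / 8, hence some f_j is missed with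
    probability at least 1 / 8. *)
Require Import Defs.
From HB Require Import structures.
From mathcomp Require Import all_boot all_order all_algebra.
From mathcomp Require Import all_classical all_reals all_analysis.
From mathcomp Require Import measurable_realfun.
From mathcomp Require Import ring lra.

Set Implicit Arguments.
Unset Strict Implicit.
Unset Printing Implicit Defensive.

Import Order.TTheory GRing.Theory Num.Theory.
Import numFieldNormedType.Exports.

Local Open Scope classical_set_scope.
Local Open Scope ring_scope.

(** * Finite powers of a sigma-finite measure *)

(* The library's sigma-finite instance on [m1 \x m2] is shadowed by a later
   instance that only covers subprobabilities. *)
Lemma sigma_finite_product_measure d1 d2 (T1 : measurableType d1)
    (T2 : measurableType d2) (R : realType)
    (m1 : {sigma_finite_measure set T1 -> \bar R})
    (m2 : {sigma_finite_measure set T2 -> \bar R}) :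
  sigma_finite setT (m1 \x m2)%E.
Proof.
have /sigma_finiteP[F [TF ndF Foo]] := sigma_finiteT m1.
have /sigma_finiteP[G [TG ndG Goo]] := sigma_finiteT m2.
exists (fun n => F n `*` G n).
  rewrite -setXTT TF TG; apply/seteqP; split => [[x y] [[n _ Fx] [k _ Gy]]|].
    exists (maxn n k) => //; split.
    - have /subsetPset := ndF _ _ (leq_maxl n k); exact.
    - have /subsetPset := ndG _ _ (leq_maxr n k); exact.
  by move=> [x y] [n _ []]; split; exists n.
move=> k; have [mF Fk] := Foo k; have [mG Gk] := Goo k.
split; first exact: measurableX.
by rewrite product_measure1E// lte_mul_pinfty// ge0_fin_numE.
Qed.

Section tuple_power_measure.
Context d (T : measurableType d) (R : realType).
Variable m : {sigma_finite_measure set T -> \bar R}.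

(** The inductive step multiplies [m] by the lower power, which must already be a sigma-finite
    measure; hence both properties are carried together in an existential, from which the instances
    on [tuple_power] are read off. *)
Lemma tuple_power_sigma_finite_measure n :
  exists mu : {sigma_finite_measure set (n.-tuple T) -> \bar R},
    mu = tuple_power m n :> (set _ -> \bar R).
Proof.
elim: n => [|n [mu muE]]; first by exists \d_[tuple].
pose phi (p : T * n.-tuple T) := [tuple of p.1 :: p.2].
have mphi : measurable_fun setT phi by exact: measurable_cons.
pose nu := pushforward (m \x mu)%E phi.
have nuE : nu = tuple_power m n.+1 by rewrite /nu /= -muE.
have sf : sigma_finite setT nu.
  have [F TF Foo] := sigma_finite_product_measure m mu.
  (* The exhaustion of the product is transported by the inverse of [phi], splitting a tuple into
     head and tail. *)
  exists (fun k => (fun t : n.+1.-tuple T => (thead t, [tuple of behead t]))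
                    @^-1` F k).
    rewrite -preimage_bigcup -[X in _ @^-1` X]TF preimage_setT//.
  move=> k; have [mF Fk] := Foo k; split.
    rewrite -[X in measurable X]setTI.
    apply: measurable_fun_pair => //; first exact: measurable_tnth.
    exact: measurable_behead.
  rewrite /nu /pushforward (_ : _ @^-1` _ = F k)//.
  by apply/seteqP; split => -[x s] /=; rewrite /phi/= ?theadE;
    (have -> : [tuple of behead [tuple of x :: s]] = s by exact/val_inj).
pose M := Measure_isSigmaFinite.Build _ _ _ nu sf.
pose nuF mf : {sigma_finite_measure set _ -> \bar R} := HB.pack nu (M mf).
by exists (nuF mphi mphi); rewrite -nuE.
Qed.

Let tuple_power0 n : tuple_power m n set0 = 0%E.
Proof. by have [mu <-] := tuple_power_sigma_finite_measure n. Qed.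

Let tuple_power_ge0 n A : (0 <= tuple_power m n A)%E.
Proof. by have [mu <-] := tuple_power_sigma_finite_measure n. Qed.

Let tuple_power_sigma_additive n : semi_sigma_additive (tuple_power m n).
Proof.
have [mu <-] := tuple_power_sigma_finite_measure n.
exact: measure_semi_sigma_additive.
Qed.

HB.instance Definition _ n := isMeasure.Build _ _ _ (tuple_power m n)
  (tuple_power0 n) (@tuple_power_ge0 n) (@tuple_power_sigma_additive n).

Let tuple_power_sigma_finite n : sigma_finite setT (tuple_power m n).
Proof.
have [mu <-] := tuple_power_sigma_finite_measure n; exact: sigma_finiteT.
Qed.

HB.instance Definition _ n := Measure_isSigmaFinite.Build _ _ _
  (tuple_power m n) (tuple_power_sigma_finite n).

Local Open Scope ereal_scope.

Lemma integral_tuple_power0 (f : 0.-tuple T -> \bar R) :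
  measurable_fun setT f -> \int[tuple_power m 0]_s f s = f [tuple].
Proof.
move=> mf; have := @integral_dirac _ _ [tuple] R setT measurableT f mf.
by rewrite diracT mul1e.
Qed.

Lemma integral_tuple_powerS n (f : n.+1.-tuple T -> \bar R) :
  measurable_fun setT f -> (forall s, 0 <= f s) ->
  \int[tuple_power m n.+1]_s f s =
  \int[m]_x \int[tuple_power m n]_s f [tuple of x :: s].
Proof.
move=> mf f0.
have mphi : measurable_fun setT
    (fun p : T * n.-tuple T => [tuple of p.1 :: p.2]).
  exact: measurable_cons.
have := @ge0_integral_pushforward _ _ _ _ R _ mphi
  (m \x tuple_power m n)%E setT f measurableT mf (fun s _ => f0 s).
rewrite preimage_setT => pushE.
have := @fubini_tonelli1 _ _ _ _ R m (tuple_power m n)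
  (fun p => f [tuple of p.1 :: p.2]).
move=> <-//; last exact: measurableT_comp.
Qed.

End tuple_power_measure.

(** * Measures given by a density *)

Section density_measure.
Context d (T : measurableType d) (R : realType).
Variables (mu : {sigma_finite_measure set T -> \bar R}) (p : T -> R).
Hypotheses (mp : measurable_fun setT p) (p_ge0 : forall x, 0 <= p x).
Hypothesis p_fin : (\int[mu]_x (p x)%:E < +oo)%E.

Local Open Scope ereal_scope.

(** The Radon-Nikodym derivative of [nu] and [p] have the same integral over every measurable set,
    so they agree almost everywhere; the change of variables known for the derivative then passes to
    [p]. *)
Lemma density_measure :
  exists2 nu : {finite_measure set T -> \bar R},
    nu = (fun A => \int[mu]_(x in A) (p x)%:E) :> (set T -> \bar R) &
    forall g : T -> \bar R, measurable_fun setT g -> (forall x, 0 <= g x) ->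
      \int[nu]_x g x = \int[mu]_x (g x * (p x)%:E).
Proof.
have mpE : measurable_fun setT (EFin \o p) by exact/measurable_EFinP.
have pE0 x : 0 <= (p x)%:E by rewrite lee_fin.
pose nu A := \int[mu]_(x in A) (p x)%:E.
have nu0 : nu set0 = 0 by rewrite /nu integral_set0.
have nu_ge0 A : 0 <= nu A by exact: integral_ge0.
have nu_sadd : semi_sigma_additive nu.
  move=> F mF tF mUF; rewrite /nu ge0_integral_bigcup//; last first.
    exact: measurable_funTS.
  by apply: is_cvg_nneseries => n _ _; exact: integral_ge0.
have nu_fin : fin_num_fun nu.
  move=> A mA; rewrite ge0_fin_numE ?nu_ge0//.
  by rewrite (le_lt_trans _ p_fin)//; exact: ge0_subset_integral.
pose nuM := isMeasure.Build _ _ _ nu nu0 nu_ge0 nu_sadd.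
pose nuM' : {measure set T -> \bar R} := HB.pack nu nuM.
pose nuF := Measure_isFinite.Build _ _ _ nuM' nu_fin.
pose nuF' : {finite_measure set T -> \bar R} := HB.pack nu nuM nuF.
exists nuF' => // g mg g0.
have numu : nuF' `<< mu.
  apply/null_content_dominatesP => A mA A0.
  by apply: null_set_integral => //; exact: measurable_funTS.
rewrite -(Radon_Nikodym_SigmaFinite.change_of_variables numu)//.
have RN0 := Radon_Nikodym_SigmaFinite.f_ge0 numu.
have mRN := measurable_int _ (Radon_Nikodym_SigmaFinite.f_integrable numu).
apply: ge0_ae_eq_integral => //.
- exact: emeasurable_funM.
- exact: emeasurable_funM.
- by move=> x _; rewrite mule_ge0.
- by move=> x _; rewrite mule_ge0.
apply: ae_eqe_mul2l.
apply: integral_ae_eq => //.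
  exact: Radon_Nikodym_SigmaFinite.f_integrable.
by move=> E _ mE; rewrite -Radon_Nikodym_SigmaFinite.f_integral.
Qed.

End density_measure.

(** * Product integrands and likelihoods on powers of a measure *)

Section tuple_power_products.
Context d (T : measurableType d) (R : realType).
Local Open Scope ereal_scope.

Lemma measurable_prod_tnth n (g : nat -> T -> R) :
  (forall i, measurable_fun setT (g i)) ->
  measurable_fun setT (fun s : n.-tuple T => \prod_(i < n) g i (tnth s i))%R.
Proof.
move=> mg; apply: measurable_prod => i _.
exact: (measurableT_comp (mg i) (measurable_tnth i)).
Qed.

(** Tonelli, one coordinate at a time. The factors are indexed by [nat] so that the induction can
    shift the family when the head is split off. *)
Lemma integral_prod_tnth (m : {sigma_finite_measure set T -> \bar R}) n
    (g : nat -> T -> R) :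
  (forall i, measurable_fun setT (g i)) -> (forall i x, (0 <= g i x)%R) ->
  \int[tuple_power m n]_s (\prod_(i < n) g i (tnth s i))%:E =
  \prod_(i < n) \int[m]_x (g i x)%:E.
Proof.
elim: n g => [|n IH] g mg g0.
  rewrite integral_tuple_power0; last first.
    by apply/measurable_EFinP; exact: measurable_prod_tnth.
  by rewrite !big_ord0.
rewrite integral_tuple_powerS; last 2 first.
- by apply/measurable_EFinP; exact: measurable_prod_tnth.
- by move=> s; rewrite lee_fin prodr_ge0.
rewrite big_ord_recl -(IH (fun i => g i.+1))//.
rewrite -ge0_integralZr//; last 3 first.
- by apply/measurable_EFinP.
- by move=> x _; rewrite lee_fin.
- by apply: integral_ge0 => s _; rewrite lee_fin prodr_ge0.
apply: eq_integral => x _; rewrite -ge0_integralZl//; last 3 first.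
- by apply/measurable_EFinP; exact: (@measurable_prod_tnth _ (fun i => g i.+1)).
- by move=> s _; rewrite lee_fin prodr_ge0.
- by rewrite lee_fin.
apply: eq_integral => s _; rewrite big_ord_recl EFinM; congr (_ * _%:E).
by apply: eq_bigr => i _; rewrite tnthS.
Qed.

(** Change of measure for an i.i.d. sample: the likelihood is the product of the densities. The
    density is inserted in the first coordinate by hypothesis and in the others by induction. *)
Lemma integral_tuple_power_density
    (mu nu : {sigma_finite_measure set T -> \bar R}) (p : T -> R) n
    (Y : n.-tuple T -> \bar R) :
  measurable_fun setT p -> (forall x, (0 <= p x)%R) ->
  (forall g : T -> \bar R, measurable_fun setT g -> (forall x, 0 <= g x) ->
      \int[nu]_x g x = \int[mu]_x (g x * (p x)%:E)) ->
  measurable_fun setT Y -> (forall s, 0 <= Y s) ->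
  \int[tuple_power nu n]_s Y s =
  \int[tuple_power mu n]_s (Y s * (\prod_(i < n) p (tnth s i))%:E).
Proof.
move=> mp p0 dens.
have mprod k : measurable_fun setT
    (fun s : k.-tuple T => (\prod_(i < k) p (tnth s i))%:E).
  by apply/measurable_EFinP; exact: (@measurable_prod_tnth _ (fun=> p)).
have prod0 k (s : k.-tuple T) : 0 <= (\prod_(i < k) p (tnth s i))%:E.
  by rewrite lee_fin prodr_ge0.
elim: n Y => [|n IH] Y mY Y0.
  rewrite !integral_tuple_power0//; last first.
    by apply: emeasurable_funM => //; exact: (mprod 0%N).
  by rewrite big_ord0 mule1.
have mYc x : measurable_fun setT (fun s : n.-tuple T => Y [tuple of x :: s]).
  by apply: (measurableT_comp mY); exact: measurable_cons.
rewrite !integral_tuple_powerS//; last 2 first.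
- by apply: emeasurable_funM => //; exact: (mprod n.+1).
- by move=> s; rewrite mule_ge0.
rewrite dens; last 2 first.
- have mYp : measurable_fun setT
      (fun q : T * n.-tuple T => Y [tuple of q.1 :: q.2]).
    by apply: (measurableT_comp mY); exact: measurable_cons.
  apply: (@measurable_fun_fubini_tonelli_F _ _ _ _ _ (tuple_power nu n) _ mYp).
  by move=> q; exact: Y0.
- by move=> x; exact: integral_ge0.
apply: eq_integral => x _; rewrite IH// -ge0_integralZr//; last 3 first.
- by apply: emeasurable_funM => //; exact: (mprod n).
- by move=> s _; rewrite mule_ge0.
- by rewrite lee_fin.
apply: eq_integral => s _; rewrite -muleA big_ord_recl EFinM; congr (_ * _).
by rewrite muleC; congr (_ * _%:E); apply: eq_bigr => i _; rewrite tnthS.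
Qed.

End tuple_power_products.

(** * Functions of the first coordinate on the unit cube, encoded on a finite set *)

Section cube_functions.
Context (R : realType) (T : finType) (t0 : T).
Implicit Types (F G : T -> R) (y : measurableTypeR R).

Let N : R := #|T|%:R.

Let N_gt0 : 0 < N.
Proof. by rewrite ltr0n; apply/card_gt0P; exists t0. Qed.

Definition mean F : R := (\sum_t F t) / #|T|%:R.

Lemma meanD F G : mean (F \+ G) = mean F + mean G.
Proof. by rewrite /mean big_split mulrDl. Qed.

Lemma meanZ (a : R) F : mean (fun t => a * F t) = a * mean F.
Proof. by rewrite /mean -mulr_sumr mulrA. Qed.

Lemma mean1 : mean (cst 1) = 1.
Proof. by rewrite /mean sumr_const divff// gt_eqF. Qed.

(** Reindexing the sum by the sign-reversing bijection [f] shows that it equals its own opposite. *)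
Lemma mean_odd F (f : T -> T) :
  involutive f -> (forall t, F (f t) = - F t) -> mean F = 0.
Proof.
move=> ff Ff; rewrite /mean; set S := \sum_t F t.
suff : S = - S by move=> SN; rewrite (_ : S = 0) ?mul0r//; lra.
rewrite {1}/S (reindex f)/=; last by exists f => ? _; exact: ff.
by rewrite /S -sumrN; apply: eq_bigr.
Qed.

(* [bin y = Some t] iff [y] lies in the cell of [t], where the cells split
   [0, 1) into #|T| intervals of equal length. *)
Definition bin y : option T :=
  [pick t | (enum_rank t)%:R <= #|T|%:R * y < (enum_rank t).+1%:R].

Definition step F y : R := oapp F 0 (bin y).

Let cell (t : T) : set (measurableTypeR R) :=
  `[(enum_rank t)%:R / N, (enum_rank t).+1%:R / N[.

(** The cells are disjoint, so at most one term survives. This form gives measurability and the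
    integral. *)
Lemma stepE F y : step F y = \sum_t F t * \1_(cell t) y.
Proof.
have cellE t : \1_(cell t) y =
    ((enum_rank t)%:R <= #|T|%:R * y < (enum_rank t).+1%:R)%R%:R :> R.
  rewrite indicE; congr (_%:R); congr nat_of_bool; rewrite /cell; apply/idP/idP.
    rewrite inE/= in_itv/= => /andP[].
    by rewrite ler_pdivrMr// ltr_pdivlMr// mulrC => -> ->.
  by rewrite inE/= in_itv/= ler_pdivrMr// ltr_pdivlMr// [y * _]mulrC.
rewrite /step /bin; case: pickP => [t /andP[t1 t2]|none] /=; last first.
  by rewrite big1// => t _; rewrite cellE none mulr0.
rewrite (bigD1 t)//= cellE t1 t2 mulr1 big1 ?addr0// => u ut.
rewrite cellE; case: andP => [[u1 u2]|]; last by rewrite mulr0.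
(* If [y] lies in two cells, each rank is below the successor of the other, so the ranks
   coincide. *)
case/eqP: ut; apply/enum_rank_inj/val_inj/eqP; rewrite eqn_leq.
move: (le_lt_trans u1 t2) (le_lt_trans t1 u2).
by rewrite !ltr_nat !ltnS => -> ->.
Qed.

Let measurable_cell t : measurable (cell t).
Proof. exact: measurable_itv. Qed.

Lemma measurable_step F : measurable_fun setT (step F).
Proof.
rewrite (_ : step F = fun y => \sum_t F t * \1_(cell t) y); last first.
  by apply/funext => y; exact: stepE.
by apply: measurable_sum => t; exact: measurable_funM.
Qed.

Lemma step_ge0 F y : (forall t, 0 <= F t) -> 0 <= step F y.
Proof. by move=> F0; rewrite /step; case: (bin y). Qed.

(** Each cell has length [1 / #|T|], so [bin] carries Lebesgue measure on [[0, 1)] to the uniform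
    law on [T]. *)
Lemma integral_step F : (forall t, 0 <= F t) ->
  (\int[lebesgue_measure]_y (step F y)%:E = (mean F)%:E)%E.
Proof.
move=> F0; under eq_integral do rewrite stepE -sumEFin.
rewrite ge0_integral_sum//; last 2 first.
- by move=> t; apply/measurable_EFinP/measurable_funM.
- by move=> t y _; rewrite lee_fin mulr_ge0// indicE.
rewrite /mean mulr_suml -sumEFin; apply: eq_bigr => t _.
under eq_integral do rewrite EFinM.
rewrite ge0_integralZl//; last 2 first.
- by apply/measurable_EFinP; exact: measurable_indic.
- by rewrite lee_fin.
rewrite integral_indic// setIT [X in (_ * X)%E](_ : _ = N^-1%:E)//.
rewrite [LHS](@lebesgue_measure_itv R) /= lte_fin ltr_pM2r ?invr_gt0//.
by rewrite ltr_nat ltnSn -EFinB -mulrBl -natrB// subSnn mul1r.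
Qed.

Variable k : nat.
Implicit Types x : Rk R k.+1.

(** Membership in the cube [[0, 1)^(k+1)] is tested by asking that [bin] be defined at every
    coordinate; the function is zero elsewhere. *)
Definition cube_fun F x : R :=
  if [forall i, bin (tnth x i) : bool] then oapp F 0 (bin (thead x)) else 0.

(** [step (cst 1)] is the indicator of [[0, 1)], so the function is a product over coordinates and
    its integral factorizes. *)
Lemma cube_funE F x :
  cube_fun F x =
  \prod_(i < k.+1) step (if i == 0%N :> nat then F else cst 1) (tnth x i).
Proof.
rewrite /cube_fun; case: ifPn => [/forallP xb|].
  rewrite big_ord_recl /= big1 ?mulr1// => i _.
  by rewrite /step /=; move: (xb (lift ord0 i)); case: bin.
rewrite negb_forall => /existsP[i xi]; rewrite (bigD1 i)//=.
by rewrite /step; move: xi; case: bin => //= _; rewrite mul0r.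
Qed.

Lemma measurable_cube_fun F : measurable_fun setT (cube_fun F).
Proof.
rewrite (_ : cube_fun F = fun x =>
  \prod_(i < k.+1) step (if i == 0%N :> nat then F else cst 1) (tnth x i)).
  apply: (@measurable_prod_tnth _ _ _ _
    (fun i => step (if i == 0%N then F else cst 1))) => i.
  exact: measurable_step.
by apply/funext => x; exact: cube_funE.
Qed.

Lemma cube_fun_ge0 F x : (forall t, 0 <= F t) -> 0 <= cube_fun F x.
Proof. by move=> F0; rewrite /cube_fun; case: ifP => // _; case: bin. Qed.

Lemma integral_cube_fun F : (forall t, 0 <= F t) ->
  (\int[lebesgue_Rk k.+1]_x (cube_fun F x)%:E = (mean F)%:E)%E.
Proof.
move=> F0; under eq_integral do rewrite cube_funE.
have H0 i t : 0 <= (if i == 0%N then F else cst 1) t by case: ifP.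
rewrite (@integral_prod_tnth _ _ _ _ _
  (fun i => step (if i == 0%N then F else cst 1))); last 2 first.
- by move=> i; exact: measurable_step.
- by move=> i y; exact: step_ge0.
rewrite big_ord_recl integral_step//= big1 ?mule1// => i _.
by rewrite integral_step//= mean1.
Qed.

End cube_functions.

(** * A lower bound on the largest of finitely many risks *)

Section testing.
Context d (S : measurableType d) (R : realType) (I : finType).
Variables (Q : {measure set S -> \bar R}) (L : I -> S -> R) (U : S -> R).
Variables (D : I -> S -> \bar R) (q eta a : R).
Hypotheses (q_gt0 : 0 < q) (eta_gt0 : 0 < eta) (a_gt0 : 0 < a).
Hypotheses (mL : forall i, measurable_fun setT (L i)).
Hypotheses (L_ge0 : forall i s, 0 <= L i s).
Hypotheses (mU : measurable_fun setT U) (U01 : forall s, 0 <= U s <= 1).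
(** In the application [Q] is a power of Lebesgue measure rather than a probability, and [U] is the
    indicator of the set of samples in the unit cube, hence the density of the uniform law. The
    identity says that the likelihoods vanish off that set. *)
Hypothesis LU : forall i s, L i s * U s = L i s.
Hypotheses (mD : forall i, measurable_fun setT (D i)).
Hypotheses (D_ge0 : forall i s, (0 <= D i s)%E).
Hypothesis D_sep :
  forall s i j, (D i s < eta%:E)%E -> (D j s < eta%:E)%E -> i = j.
Hypothesis intL : forall i, (\int[Q]_s (L i s)%:E = 1)%E.
Hypothesis intL2 : forall i, (\int[Q]_s (L i s ^+ 2)%:E <= a%:E)%E.
Hypothesis intU : (\int[Q]_s (U s)%:E <= 1)%E.
Hypothesis aI : 4 * a < 3 * #|I|%:R.

Local Open Scope ereal_scope.

Let h : R := (eta `^ q)%R.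
(** Chosen so that [h = 2 a b], the coefficient of the cross term in [b (L - a U)^2]. *)
Let b : R := (h / (2 * a))%R.

Let h_gt0 : (0 < h)%R. Proof. exact: powR_gt0. Qed.
Let b_gt0 : (0 < b)%R. Proof. by rewrite divr_gt0// mulr_gt0. Qed.
Let hE : h = (2 * a * b)%R.
Proof. by rewrite /b mulrCA divff ?mulr1// gt_eqF// mulr_gt0. Qed.

Let b_ge0 : (0 <= b)%R := ltW b_gt0.
Let ba_ge0 : (0 <= b * a ^+ 2)%R. Proof. by rewrite mulr_ge0 ?sqr_ge0. Qed.
Let baU_ge0 s : (0 <= b * a ^+ 2 * U s)%R.
Proof. by have /andP[U0 _] := U01 s; rewrite mulr_ge0. Qed.

(* AM-GM bounds [h L] by [b L^2 + b a^2 U] where the loss is small. *)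
Let risk_term i s : (h * L i s)%:E <= D i s `^ q * (L i s)%:E +
  (b * L i s ^+ 2)%:E + (if (D i s < eta%:E)%E then b * a ^+ 2 * U s else 0)%:E.
Proof.
have bL2 : (0 <= b * L i s ^+ 2)%R by rewrite mulr_ge0 ?sqr_ge0.
case: (ltP (D i s)) => Deta; last first.
  rewrite adde0 EFinM.
  apply: (@le_trans _ _ (D i s `^ q * (L i s)%:E)); last first.
    by rewrite leeDl ?lee_fin.
  rewrite lee_wpmul2r ?lee_fin// -poweR_EFin.
  by rewrite gt0_ler_poweR ?in_itv/= ?lee_fin ?leey ?andbT// ltW.
rewrite -addeA -EFinD.
apply: (@le_trans _ _ (b * L i s ^+ 2 + b * a ^+ 2 * U s)%:E); last first.
  by rewrite leeDr// mule_ge0 ?poweR_ge0 ?lee_fin.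
have /andP[U0 U1] := U01 s.
have sq : (0 <= b * (L i s - a * U s) ^+ 2)%R by rewrite mulr_ge0 ?sqr_ge0.
(* Allows the [U^2] of the expanded square to be replaced by [U]. *)
have UU : (0 <= b * a ^+ 2 * (U s * (1 - U s)))%R.
  by rewrite mulr_ge0 ?ba_ge0// mulr_ge0 ?subr_ge0.
have -> : (h * L i s = 2 * a * b * (L i s * U s))%R by rewrite LU hE.
rewrite lee_fin; lra.
Qed.

(** By separation at most one index has a loss below [eta], so at most one term is nonzero. *)
Let sum_small s :
  (\sum_i (if (D i s < eta%:E)%E then b * a ^+ 2 * U s else 0) <=
   b * a ^+ 2 * U s)%R.
Proof.
case: (pickP (fun i => D i s < eta%:E)) => [i Di|none]; last first.
  by rewrite big1// => i _; rewrite none.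
rewrite (bigD1 i)//= Di big1 ?addr0// => j ji.
by case: ifPn => // Dj; case/eqP: ji; exact: (D_sep Dj Di).
Qed.

(** The pointwise bound [risk_term] is summed over [i] and integrated. The small-loss terms together
    cost only [b a^2], not [#|I|] times that, which is too little if all risks are below [h / 8]. *)
Lemma exists_large_risk :
  exists i, (h / 8)%:E <= \int[Q]_s (D i s `^ q * (L i s)%:E).
Proof.
apply: contrapT => /forallNP small.
have mDL i : measurable_fun setT (fun s => D i s `^ q * (L i s)%:E).
  apply: emeasurable_funM; last exact/measurable_EFinP.
  exact: (measurableT_comp (measurable_poweR q)).
have DL_ge0 i s : 0 <= D i s `^ q * (L i s)%:E.
  by rewrite mule_ge0 ?poweR_ge0 ?lee_fin.
have mL2 i : measurable_fun setT (fun s => (b * L i s ^+ 2)%:E).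
  by apply/measurable_EFinP/measurable_funM => //; exact: measurable_funX.
have L2_ge0 i s : 0 <= (b * L i s ^+ 2)%:E.
  by rewrite lee_fin mulr_ge0 ?sqr_ge0.
have mUc : measurable_fun setT (fun s => (b * a ^+ 2 * U s)%:E).
  by apply/measurable_EFinP/measurable_funM.
have Uc_ge0 s : 0 <= (b * a ^+ 2 * U s)%:E by rewrite lee_fin.
have mDL2 i : measurable_fun setT
    (fun s => D i s `^ q * (L i s)%:E + (b * L i s ^+ 2)%:E).
  exact: emeasurable_funD.
have : \int[Q]_s (\sum_i (h * L i s)%:E) <=
    \int[Q]_s (\sum_i (D i s `^ q * (L i s)%:E + (b * L i s ^+ 2)%:E) +
               (b * a ^+ 2 * U s)%:E).
  apply: ge0_le_integral => //.
  - by move=> s _; apply: sume_ge0 => i _; rewrite lee_fin mulr_ge0// ltW.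
  - apply: emeasurable_sum => i.
    by apply/measurable_EFinP/measurable_funM.
  - by apply: emeasurable_funD => //; exact: emeasurable_sum.
  - move=> s _; apply: (le_trans (lee_sum _ (fun i _ => risk_term i s))).
    by rewrite big_split/= leeD2l// sumEFin lee_fin.
rewrite ge0_integral_sum//; last 2 first.
- by move=> i; apply/measurable_EFinP/measurable_funM.
- by move=> i s _; rewrite lee_fin mulr_ge0// ltW.
rewrite ge0_integralD//; last 2 first.
- by move=> s _; apply: sume_ge0 => i _; exact: adde_ge0.
- exact: emeasurable_sum.
rewrite ge0_integral_sum//; last by move=> i s _; exact: adde_ge0.
have intLE i : \int[Q]_s (h * L i s)%:E = h%:E.
  under eq_integral do rewrite EFinM.
  rewrite ge0_integralZl ?intL ?mule1//; last 2 first.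
  - by move=> s _; rewrite lee_fin.
  - by rewrite lee_fin ltW.
  exact/measurable_EFinP.
have intUE : \int[Q]_s (b * a ^+ 2 * U s)%:E <= (b * a ^+ 2)%:E.
  under eq_integral do rewrite EFinM.
  rewrite ge0_integralZl//; last 2 first.
  - exact/measurable_EFinP.
  - by move=> s _; have /andP[] := U01 s; rewrite lee_fin.
  by rewrite -[leRHS]mule1 lee_wpmul2l// lee_fin.
have intDE i : \int[Q]_s (D i s `^ q * (L i s)%:E + (b * L i s ^+ 2)%:E) <=
    (h / 8 + b * a)%:E.
  rewrite ge0_integralD// EFinD leeD//.
    by rewrite ltW// ltNge; exact/negP/small.
  under eq_integral do rewrite EFinM.
  rewrite ge0_integralZl//; last 2 first.
  - by apply/measurable_EFinP; exact: measurable_funX.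
  - by move=> s _; rewrite lee_fin sqr_ge0.
  by rewrite [leRHS]EFinM lee_wpmul2l// lee_fin.
under eq_bigr do rewrite intLE.
move=> /le_trans/(_ (leeD (lee_sum _ (fun i _ => intDE i)) intUE)).
have sumc (c : R) : \sum_(i : I) c%:E = (#|I|%:R * c)%:E.
  by rewrite sumEFin sumr_const mulr_natl.
rewrite !sumc -EFinD lee_fin.
(* As [h = 2 a b], the integrated bound reads [2 a b #|I| <= #|I| (a b / 4 + a b) + b a^2], that is
   [3 #|I| <= 4 a], contradicting [aI]. *)
have : (0 < b * a * (3 * #|I|%:R - 4 * a))%R.
  by rewrite mulr_gt0 ?subr_gt0// mulr_gt0.
rewrite hE; set c := #|I|%:R; move: (b) => e; lra.
Qed.

End testing.

(** * The L1-distance *)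

HB.instance Definition _ (R : realType) (k : nat) :=
  SigmaFiniteMeasure.copy (@lebesgue_Rk R k)
    (tuple_power (@lebesgue_measure R) k).

Section v_dist_theory.
Context (R : realType) (k : nat).
Implicit Types f g h : Rk R k -> R.
Local Open Scope ereal_scope.

Lemma v_dist_ge0 f g : 0 <= v_dist f g.
Proof. by apply: integral_ge0 => x _; rewrite lee_fin. Qed.

Lemma v_distxx f : v_dist f f = 0.
Proof. by apply: integral0_eq => x _; rewrite subrr normr0. Qed.

Lemma v_dist_triangle f g h :
  measurable_fun setT f -> measurable_fun setT g -> measurable_fun setT h ->
  v_dist f h <= v_dist f g + v_dist h g.
Proof.
move=> mf mg mh.
have mB (u v : Rk R k -> R) : measurable_fun setT u -> measurable_fun setT v ->
    measurable_fun setT (fun x => `|u x - v x|%:E).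
  move=> mu mv; apply/measurable_EFinP.
  apply: (measurableT_comp (@normr_measurable R setT)).
  exact: measurable_funB.
rewrite /v_dist -ge0_integralD//; try exact: mB.
apply: ge0_le_integral => //.
- exact: mB.
- by apply: emeasurable_funD; exact: mB.
- move=> x _; rewrite -EFinD lee_fin [X in (_ <= _ + X)%R]distrC.
  by rewrite (le_trans _ (ler_normD _ _))// addrA subrK.
Qed.

(** Tonelli's theorem makes a partial integral measurable in its parameter; this is where joint
    measurability of an estimator enters. *)
Lemma measurable_v_dist d (S : measurableType d) f (g : S -> Rk R k -> R) :
  measurable_fun setT f ->
  measurable_fun setT (fun p : S * Rk R k => g p.1 p.2) ->
  measurable_fun setT (fun s => v_dist f (g s)).
Proof.
move=> mf mg.
have mfg : measurable_fun setT
    (fun p : S * Rk R k => `|f p.2 - g p.1 p.2|%:E).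
  apply/measurable_EFinP.
  apply: (measurableT_comp (@normr_measurable R setT)).
  by apply: measurable_funB => //; exact: measurableT_comp.
apply: (@measurable_fun_fubini_tonelli_F _ _ _ _ _ (@lebesgue_Rk R k) _ mfg).
by move=> p; rewrite lee_fin.
Qed.

End v_dist_theory.

(** * Rademacher signs and their moments *)

Section rademacher.
Context (R : realType) (M : nat).

Let T := {ffun 'I_M -> bool}.
Let t0 : T := [ffun => false].

(** Under the uniform law on the [2^M] sign vectors these are independent Rademacher variables;
    composed with [bin] they become functions of one real coordinate. *)
Definition rad (j : 'I_M) (t : T) : R := (-1) ^+ t j.

Let flip (j : 'I_M) (t : T) : T := [ffun i => (i == j) (+) t i].

Let flipK j : involutive (flip j).
Proof. by move=> t; apply/ffunP => i; rewrite !ffunE addbA addbb. Qed.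

Let rad_flip i j t : rad j (flip i t) = (-1) ^+ (j == i) * rad j t.
Proof. by rewrite /rad ffunE signr_addb. Qed.

Lemma mean_rad j : mean (rad j) = 0.
Proof.
by apply: (mean_odd (flipK j)) => t; rewrite rad_flip eqxx expr1 mulN1r.
Qed.

(** Flipping coordinate [i] negates [rad i] and keeps [rad j], so the product is odd. *)
Lemma mean_radM i j : i != j -> mean (fun t => rad i t * rad j t) = 0.
Proof.
move=> ij; apply: (mean_odd (flipK i)) => t; rewrite !rad_flip eqxx.
by rewrite eq_sym (negbTE ij) expr1 expr0 mul1r mulN1r mulNr.
Qed.

Variable eps : R.

Definition tilt j (t : T) : R := 1 + eps * rad j t.

Lemma mean_tilt j : mean (tilt j) = 1.
Proof.
rewrite (_ : tilt j = cst 1 \+ (fun t => eps * rad j t))//.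
by rewrite meanD meanZ mean_rad mulr0 addr0 (mean1 _ t0).
Qed.

(** Uses [rad j ^ 2 = 1]. The value is one plus the chi-square divergence of the tilted law from the
    uniform law. *)
Lemma mean_tilt_sqr j : mean (fun t => tilt j t ^+ 2) = 1 + eps ^+ 2.
Proof.
rewrite (_ : (fun t => _) = (fun t => (1 + eps ^+ 2) * cst 1 t) \+
                            (fun t => (2 * eps) * rad j t)); last first.
  by apply/funext => t; rewrite /tilt /rad /=; case: (t j); ring.
by rewrite meanD !meanZ mean_rad (mean1 _ t0) mulr0 addr0 mulr1.
Qed.

(** Signs satisfy [|r_i - r_j| = 1 - r_i r_j], and the product has mean zero. *)
Lemma mean_tilt_dist i j : 0 <= eps -> i != j ->
  mean (fun t => `|tilt i t - tilt j t|) = eps.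
Proof.
move=> eps0 ij.
rewrite (_ : (fun t => _) = (fun t => eps * cst 1 t) \+
                            (fun t => - eps * (rad i t * rad j t))); last first.
  apply/funext => t; rewrite /tilt opprD addrACA subrr add0r -mulrBr normrM.
  rewrite ger0_norm// /rad /=.
  case: (t i) (t j) => -[];
    rewrite ?expr1 ?expr0 ?subrr ?opprK ?normr0; try ring.
    by rewrite -opprD normrN ger0_norm; [ring|].
  by rewrite ger0_norm; [ring|].
by rewrite meanD !meanZ mean_radM// (mean1 _ t0) mulr0 addr0 mulr1.
Qed.

Hypothesis eps01 : 0 <= eps <= 1.

Lemma tilt_itv j t : 0 <= tilt j t <= 1 + eps.
Proof.
have /andP[e0 e1] := eps01; rewrite /tilt /rad.
by case: (t j); rewrite ?expr1 ?expr0; apply/andP; split; lra.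
Qed.

End rademacher.

(** * The hard family of densities and its minimax risk *)

Section minimax.
Context (R : realType) (k n M : nat) (eps q : R).
Hypotheses (eps01 : 0 < eps <= 1) (q_gt0 : 0 < q).
Hypothesis epsM : 4 * (1 + eps ^+ 2) ^+ n < 3 * M%:R.

Definition rad_density (j : 'I_M) : Rk R k.+1 -> R := cube_fun (tilt eps j).

Let t0 : {ffun 'I_M -> bool} := [ffun => false].
Let eps_ge0 : 0 <= eps. Proof. by case/andP: eps01 => /ltW. Qed.
Let eps01W : 0 <= eps <= 1.
Proof. by case/andP: eps01 => /ltW -> ->. Qed.
Let tilt_ge0 (j : 'I_M) t : 0 <= tilt eps j t.
Proof. by have /andP[] := tilt_itv eps01W j t. Qed.

Lemma measurable_rad_density j : measurable_fun setT (rad_density j).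
Proof. exact: measurable_cube_fun. Qed.

Lemma rad_density_itv j x : 0 <= rad_density j x <= 1 + eps.
Proof.
rewrite /rad_density /cube_fun; case: ifP => _; last by rewrite lexx addr_ge0.
case: bin => [t|] /=; last by rewrite lexx addr_ge0.
exact: tilt_itv.
Qed.

Lemma integral_rad_density j :
  (\int[lebesgue_Rk k.+1]_x (rad_density j x)%:E = 1)%E.
Proof. by rewrite (integral_cube_fun t0)// mean_tilt. Qed.

Lemma v_dist_rad_density i j : i != j ->
  v_dist (rad_density i) (rad_density j) = eps%:E.
Proof.
move=> ij; rewrite -[in RHS](mean_tilt_dist eps_ge0 ij).
rewrite -(integral_cube_fun t0 k)//; apply: eq_integral => x _; congr EFin.
rewrite /rad_density /cube_fun; case: ifP => _; last by rewrite subrr normr0.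
by case: bin => //=; rewrite subrr normr0.
Qed.

Lemma bounded_rad_density A j :
  1 + eps <= A -> bounded_densities A (rad_density j).
Proof.
move=> epsA; split; [exact: measurable_rad_density| |].
  by move=> x; have /andP[-> /= /le_trans] := rad_density_itv j x; apply.
exact: integral_rad_density.
Qed.

Lemma minimax_lower_bound (fhat : n.-tuple (Rk R k.+1) -> Rk R k.+1 -> R) :
  estimators fhat ->
  exists j, (((eps / 2) `^ q / 8)%:E <=
    expect (rad_density j) (fun s => v_dist (rad_density j) (fhat s) `^ q))%E.
Proof.
move=> mfhat.
have rad_density_ge0 j x : 0 <= rad_density j x.
  by have /andP[] := rad_density_itv j x.
pose L j (s : n.-tuple (Rk R k.+1)) := \prod_(i < n) rad_density j (tnth s i).
(* The indicator of the unit cube, that is, the uniform density. *)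
pose one : Rk R k.+1 -> R := cube_fun (cst 1 : {ffun 'I_M -> bool} -> R).
pose U (s : n.-tuple (Rk R k.+1)) := \prod_(i < n) one (tnth s i).
(* Change of measure: all [M] risks become integrals against one power of Lebesgue measure, weighted
   by the likelihoods. *)
have expectE j : expect (rad_density j)
      (fun s => v_dist (rad_density j) (fhat s) `^ q)%E =
    (\int[tuple_power (@lebesgue_Rk R k.+1) n]_s
      (v_dist (rad_density j) (fhat s) `^ q * (L j s)%:E))%E.
  have int_fin : (\int[lebesgue_Rk k.+1]_x (rad_density j x)%:E < +oo)%E.
    by rewrite integral_rad_density ltry.
  have mp := measurable_rad_density j.
  have [nu nuE dens] := density_measure mp (rad_density_ge0 j) int_fin.
  rewrite /expect (_ : density_law (rad_density j) = nu)//.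
  apply: (integral_tuple_power_density mp (rad_density_ge0 j) dens).
    apply: (measurableT_comp (measurable_poweR q)).
    exact: measurable_v_dist mp mfhat.
  by move=> s; exact: poweR_ge0.
(* The integrals of [L j], its square and [U] are all [n]-th powers of averages over sign
   vectors. *)
have int_prod (F : {ffun 'I_M -> bool} -> R) : (forall t, 0 <= F t) ->
    (\int[tuple_power (@lebesgue_Rk R k.+1) n]_s
      (\prod_(i < n) cube_fun F (tnth s i))%:E = (mean F ^+ n)%:E)%E.
  move=> F0; rewrite (@integral_prod_tnth _ _ _ _ _ (fun=> cube_fun F)).
  - rewrite (eq_bigr (fun=> (mean F)%:E)); last first.
      by move=> i _; exact: integral_cube_fun.
    by rewrite prodEFin prodr_const card_ord.
  - by move=> i; exact: measurable_cube_fun.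
  - by move=> i x; exact: cube_fun_ge0.
have one01 x : 0 <= one x <= 1.
  rewrite /one /cube_fun; case: ifP => _; last by rewrite lexx ler01.
  by case: bin => /= *; rewrite ?lexx ler01.
have LU j s : L j s * U s = L j s.
  rewrite /L /U -big_split; apply: eq_bigr => i _ /=.
  rewrite /rad_density /one /cube_fun; case: ifP => _; last by rewrite mul0r.
  by case: bin => [t|] /=; rewrite ?mulr1 ?mul0r.
have L2 j s : L j s ^+ 2 =
    \prod_(i < n) cube_fun (fun t => tilt eps j t ^+ 2) (tnth s i).
  rewrite /L -prodrXl; apply: eq_bigr => i _.
  rewrite /rad_density /cube_fun; case: ifP => _; last by rewrite expr0n.
  by case: bin => //=; rewrite expr0n.
have e2_gt0 : 0 < eps / 2 by have /andP[e0 _] := eps01; rewrite divr_gt0.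
have a_gt0 : 0 < (1 + eps ^+ 2) ^+ n.
  by rewrite exprn_gt0// ltr_wpDr ?sqr_ge0.
have aM : 4 * (1 + eps ^+ 2) ^+ n < 3 * #|'I_M|%:R by rewrite card_ord.
have mL j : measurable_fun setT (L j).
  apply: (@measurable_prod_tnth _ _ R n (fun=> rad_density j)) => _.
  exact: measurable_rad_density.
have mU : measurable_fun setT U.
  apply: (@measurable_prod_tnth _ _ R n (fun=> one)) => _.
  exact: measurable_cube_fun.
have L_ge0 j s : 0 <= L j s by apply: prodr_ge0.
have U01 s : 0 <= U s <= 1.
  have one_ge0 x : 0 <= one x by have /andP[] := one01 x.
  by apply/andP; split; [exact: prodr_ge0|exact: prodr_ile1].
have mD j : measurable_fun setT (fun s => v_dist (rad_density j) (fhat s)).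
  exact: measurable_v_dist (measurable_rad_density j) mfhat.
(* Otherwise the triangle inequality would give [eps < eps / 2 + eps / 2]. *)
have D_sep s i j : (v_dist (rad_density i) (fhat s) < (eps / 2)%:E)%E ->
    (v_dist (rad_density j) (fhat s) < (eps / 2)%:E)%E -> i = j.
  move=> Di Dj; apply/eqP; apply: contraT => ij.
  have mfs : measurable_fun setT (fhat s).
    exact: (@measurable_fun_pair2 _ _ _ _ _ _ (fun p => fhat p.1 p.2) s mfhat).
  have := v_dist_triangle (measurable_rad_density i) mfs
    (measurable_rad_density j).
  rewrite (v_dist_rad_density ij) leNgt (lt_le_trans (lteD Di Dj))//.
  by rewrite -EFinD lee_fin; lra.
have intL j : (\int[tuple_power (@lebesgue_Rk R k.+1) n]_s (L j s)%:E = 1)%E.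
  by rewrite int_prod// mean_tilt expr1n.
have intL2 j : (\int[tuple_power (@lebesgue_Rk R k.+1) n]_s (L j s ^+ 2)%:E <=
    ((1 + eps ^+ 2) ^+ n)%:E)%E.
  under eq_integral do rewrite L2.
  by rewrite int_prod ?mean_tilt_sqr// => t; exact: sqr_ge0.
have intU : (\int[tuple_power (@lebesgue_Rk R k.+1) n]_s (U s)%:E <= 1)%E.
  by rewrite int_prod// (mean1 _ t0) expr1n.
have [j le_j] := exists_large_risk q_gt0 e2_gt0 a_gt0 mL L_ge0 mU U01 LU mD
  (fun j s => v_dist_ge0 _ _) D_sep intL intL2 intU aM.
by exists j; rewrite expectE.
Qed.

End minimax.

(** * Calibration of [eps] and the lower bound *)

(** With [x = ln M / (16 n)], [(1 + x)^(2 n) <= exp (2 n x) = M^(1/8) <= M], so the power is at most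
    [sqrt M]; and [4 sqrt M < 3 M] because [16 < 9 M] from [M = 2] on. *)
Lemma chi2_bound (R : realType) (M n : nat) : (2 <= M)%N -> (0 < n)%N ->
  4 * (1 + (Num.sqrt (ln (M%:R : R) / n%:R) / 4) ^+ 2) ^+ n < 3 * M%:R :> R.
Proof.
move=> M2 n0; set l := ln (M%:R : R).
have M1 : 1 <= M%:R :> R by rewrite ler1n; exact: leq_trans M2.
have M2R : 2 <= M%:R :> R by rewrite ler_nat.
have l0 : 0 <= l by exact: ln_ge0.
have nR : 0 < n%:R :> R by rewrite ltr0n.
have -> : (Num.sqrt (l / n%:R) / 4) ^+ 2 = l / n%:R / 16.
  rewrite expr_div_n sqr_sqrtr; first by rewrite -natrX.
  by rewrite divr_ge0// ltW.
set x := l / n%:R / 16; have x0 : 0 <= x by rewrite !divr_ge0// ltW.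
set a := (1 + x) ^+ n; have a0 : 0 <= a by rewrite exprn_ge0// addr_ge0.
have aM : a ^+ 2 <= M%:R.
  rewrite -[leRHS]lnK ?posrE; last exact: lt_le_trans M1.
  rewrite -exprM mulnC exprM.
  apply: (@le_trans _ _ ((expR x ^+ 2) ^+ n)).
    by rewrite lerXn2r ?nnegrE ?exprn_ge0 ?addr_ge0 ?expR_ge0//
      lerXn2r ?nnegrE ?addr_ge0 ?expR_ge0// expR_ge1Dx.
  rewrite -!expRM_natl ler_expR -/l.
  have -> : n%:R * (2 * x) = l / 8 by rewrite /x; field; rewrite gt_eqF.
  lra.
rewrite -ltr_sqr ?nnegrE ?mulr_ge0//; nra.
Qed.

Theorem theorem4 (R : realType) (A q : R) (hA : 1 < A) (hq : 0 < q) :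
  exists2 c : R, 0 < c &
    forall k M n : nat, (0 < k)%N -> (2 <= M)%N ->
      ln (M%:R : R) <= 16 * (Num.min 1 (A - 1)) ^+ 2 * n%:R ->
      ((c * (ln (M%:R : R) / n%:R) `^ (q / 2))%:E <=
        ereal_sup
          [set ereal_inf
            [set ereal_sup
              [set excess_risk q fs fhat f | f in @bounded_densities R k A]
            | fhat in @estimators R k n]
          | fs in [set fs : 'I_M -> Rk R k -> R |
                     forall j, bounded_functions A (fs j)]])%E.
Proof.
(* Since [eps / 2 = sqrt r / 8] below, [(eps / 2)^q / 8] is this constant times [r^(q/2)]. *)
exists (8^-1 `^ q / 8); first by rewrite divr_gt0// powR_gt0.
move=> [//|k] M n _ M2; set m := Num.min 1 (A - 1) => lnM.
have lM_gt0 : 0 < ln (M%:R : R) by rewrite ln_gt0// ltr1n.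
have n_gt0 : (0 < n)%N.
  by case: n lnM => //; rewrite mulr0 leNgt lM_gt0.
have nR_gt0 : 0 < n%:R :> R by rewrite ltr0n.
have m_ge0 : 0 <= m by rewrite le_min ler01 subr_ge0 ltW.
set r := ln (M%:R : R) / n%:R; have r_gt0 : 0 < r by rewrite divr_gt0.
pose eps := Num.sqrt r / 4.
have eps_gt0 : 0 < eps by rewrite divr_gt0// sqrtr_gt0.
(* This is the hypothesis on [ln M], rewritten as [r <= 16 m^2]. Then [eps <= 1] keeps the densities
   nonnegative and [eps <= A - 1] keeps them below [A]. *)
have eps_m : eps <= m.
  rewrite ler_pdivrMr// -ler_sqr ?nnegrE ?sqrtr_ge0 ?mulr_ge0//.
  rewrite sqr_sqrtr ?(ltW r_gt0)// ler_pdivrMr// (le_trans lnM)//.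
  by rewrite le_eqVlt; apply/orP; left; apply/eqP; ring.
have eps01 : 0 < eps <= 1 by rewrite eps_gt0 (le_trans eps_m)// ge_min lexx.
have epsA : 1 + eps <= A.
  by rewrite -lerBrDl (le_trans eps_m)// ge_min lexx orbT.
apply: le_ereal_sup_tmp; eexists; first exists (@rad_density R k M eps) => //.
  move=> j; split; first exact: measurable_rad_density.
  by move=> x; have /andP[h0 hA'] := rad_density_itv eps01 j x;
    rewrite ger0_norm// (le_trans hA').
apply/ereal_infP => _ [fhat mfhat <-].
have [j le_j] := minimax_lower_bound eps01 hq (chi2_bound R M2 n_gt0) mfhat.
apply: le_ereal_sup_tmp.
exists (excess_risk q (@rad_density R k M eps) fhat (rad_density eps j)).
  by exists (rad_density eps j) => //; exact: bounded_rad_density.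
have -> : 8^-1 `^ q / 8 * r `^ (q / 2) = (eps / 2) `^ q / 8.
  rewrite mulrAC; congr (_ / _).
  rewrite [q / 2]mulrC powRrM powR12_sqrt ?(ltW r_gt0)//.
  by rewrite -powRM ?sqrtr_ge0//; congr (_ `^ _); rewrite /eps; field.
(* The true density is one of the [f_j], so the minimum is at most its [j]-th term, which is [0]
   since [q > 0]; subtracting it cannot lower the risk. *)
apply: (le_trans le_j); rewrite /excess_risk leeDl// oppe_ge0.
apply: (@bigmin_inf _ _ _ _ j) => //.
by rewrite v_distxx poweR0r// gt_eqF.
Qed.
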